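(* Let $k\ge 1$ be an integer and let $$\mathcal H_k=\langle x,y,z\mid [x,y]=z,\ [x,z]=1,\ [y,z]=1,\ z^{k}=1\rangle .$$ Then the trivial $\mathbb{Z}\mathcal H_k$-module $\mathbb{Z}$ has a free resolution, $2$-periodic in degrees $\ge 2$, of the form $$\cdots\xrightarrow{\partial_3}\mathbb{Z}\mathcal H_k^{4}\xrightarrow{\partial_4}\mathbb{Z}\mathcal H_k^{4}\xrightarrow{\partial_3}\mathbb{Z}\mathcal H_k^{4}\xrightarrow{\partial_2}\mathbb{Z}\mathcal H_k^{3}\xrightarrow{\partial_1}\mathbb{Z}\mathcal H_k\xrightarrow{\varepsilon}\mathbb{Z}\to0,$$ where the differential in every odd degree $\ge3$ is $\partial_3$, the differential in every even degree $\ge4$ is $\partial_4$, and $$\partial_1=\begin{bmatrix} x-1 \\ y-1 \\ z-1 \end{bmatrix},\quad \partial_2=\begin{bmatrix} 0 & 0 & \mathbf N_z^{k-1} \\ 1-zy & x-z & -1 \\ 1-z & 0 & x-1 \\ 0 & 1-z & y-1 \end{bmatrix},$$ $$\partial_3=\begin{bmatrix} x-1 & 0 & -\mathbf N_z^{k-1} & 0 \\ y-1 & 0 & 0 & -\mathbf N_z^{k-1} \\ z-1 & 0 & 0 & 0 \\ 0 & z-1 & 1-zy & x-z \end{bmatrix},\quad \partial_4=\begin{bmatrix} 0 & 0 & \mathbf N_z^{k-1} & 0 \\ 1-zy & x-z & -1 & \mathbf N_z^{k-1} \\ 1-z & 0 & x-1 & 0 \\ 0 & 1-z & y-1 & 0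 \end{bmatrix}.$$
   Context: All modules are left modules. The commutator is $[g,h]=ghg^{-1}h^{-1}$. A map of free modules $A^{r}\to A^{s}$ over a ring $A$ is represented by an $r\times s$ matrix acting on the right of row vectors. For a group element $g$ and an integer $m\ge0$, $\mathbf N_g^{m}:=\sum_{i=0}^{m}g^i$ in the integral group ring. $\varepsilon$ is the augmentation map. *)

(* Defs.v *)
From HB Require Import structures.
From mathcomp Require Import all_boot all_order all_algebra.
From mathcomp Require Import generic_quotient boolp finmap.
From mathcomp.multinomials Require Import xfinmap monalg.

Set Implicit Arguments.
Unset Strict Implicit.
Unset Printing Implicit Defensive.

Import GRing.Theory.

Local Open Scope ring_scope.

(* A letter (a, false) of a word stands for the generator a, and (a, true) for
   its formal inverse. *)
Definition word (X : Type) := seq (X * bool).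

Definition winv {X : Type} (u : word X) : word X :=
  rev [seq (a.1, ~~ a.2) | a <- u].

(* The convention g h g^-1 h^-1, not that of the library's [~ g, h]. *)
Definition wcomm {X : Type} (u v : word X) : word X :=
  u ++ v ++ winv u ++ winv v.

(* The least congruence on words that contains free cancellation and the
   relations u = v for (u, v) in R; its classes are the elements of < X | R >. *)
Inductive pres_eq (X : eqType) (R : seq (word X * word X)) :
    word X -> word X -> Prop :=
| pres_refl u : pres_eq R u u
| pres_sym u v : pres_eq R u v -> pres_eq R v u
| pres_trans u v w : pres_eq R u v -> pres_eq R v w -> pres_eq R u w
| pres_cat u u' v v' :
    pres_eq R u u' -> pres_eq R v v' -> pres_eq R (u ++ v) (u' ++ v')
| pres_cancel a b : pres_eq R [:: (a, b); (a, ~~ b)] [::]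
| pres_rel u v : (u, v) \in R -> pres_eq R u v.

Section Presentation.
Variables (X : choiceType) (R : seq (word X * word X)).
Implicit Types u v : word X.

Definition pres_eqb u v : bool := `[< pres_eq R u v >].

Lemma pres_eqb_refl : reflexive pres_eqb.
Proof. by move=> u; apply/asboolP/pres_refl. Qed.

Lemma pres_eqb_sym : symmetric pres_eqb.
Proof. by move=> u v; apply/asboolP/asboolP => /pres_sym. Qed.

Lemma pres_eqb_trans : transitive pres_eqb.
Proof.
by move=> v u w /asboolP uv /asboolP vw; apply/asboolP/(pres_trans uv vw).
Qed.

Canonical pres_equiv :=
  EquivRel pres_eqb pres_eqb_refl pres_eqb_sym pres_eqb_trans.

Definition presented := {eq_quot pres_equiv}%qT.

HB.instance Definition _ := Choice.on presented.
HB.instance Definition _ := EqQuotient.on presented.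

Definition pword u : presented := (\pi_presented u)%qT.

Lemma pwordP u v : reflect (pres_eq R u v) (pword u == pword v).
Proof.
rewrite (_ : (_ == _) = pres_eqb u v); first exact: asboolP.
exact: (@eqquotE _ _ presented).
Qed.

Lemma repr_pword u : pres_eq R (repr (pword u)) u.
Proof. by apply/pwordP; rewrite /pword reprK. Qed.

Lemma pwordK (g : presented) : pword (repr g) = g.
Proof. exact: reprK. Qed.

Lemma winv_cat u v : winv (u ++ v) = winv v ++ winv u.
Proof. by rewrite /winv map_cat rev_cat. Qed.

Lemma winvK u : winv (winv u) = u.
Proof.
rewrite /winv map_rev revK -map_comp.
by rewrite (@eq_map _ _ _ id) ?map_id // => -[a b] /=; rewrite negbK.
Qed.

Lemma pres_mulVw u : pres_eq R (winv u ++ u) [::].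
Proof.
elim: u => [|[a b] u IHu]; first exact: pres_refl.
rewrite -cat1s winv_cat -catA (catA (winv [:: _])).
apply: pres_trans IHu; apply: pres_cat (pres_refl _ _) _.
rewrite -[X in pres_eq _ _ X]cat0s; apply: pres_cat (pres_refl _ _).
by have := pres_cancel R a (~~ b); rewrite negbK.
Qed.

Lemma pres_mulwV u : pres_eq R (u ++ winv u) [::].
Proof. by have := pres_mulVw (winv u); rewrite winvK. Qed.

Lemma pres_winv u v : pres_eq R u v -> pres_eq R (winv u) (winv v).
Proof.
move=> uv; apply: (@pres_trans _ _ _ (winv u ++ (v ++ winv v))).
  rewrite -[X in pres_eq _ X _]cats0; apply: pres_cat (pres_refl _ _) _.
  exact/pres_sym/pres_mulwV.
rewrite catA -[X in pres_eq _ _ X]cat0s; apply: pres_cat (pres_refl _ _).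
apply: pres_trans (pres_mulVw u); apply: pres_cat (pres_refl _ _) _.
exact: pres_sym.
Qed.

Definition pres_one : presented := pword [::].
Definition pres_mul (g h : presented) : presented := pword (repr g ++ repr h).
Definition pres_inv (g : presented) : presented := pword (winv (repr g)).

Lemma pres_mulE u v : pres_mul (pword u) (pword v) = pword (u ++ v).
Proof. by apply/eqP/pwordP/pres_cat; apply: repr_pword. Qed.

Lemma pres_invE u : pres_inv (pword u) = pword (winv u).
Proof. by apply/eqP/pwordP/pres_winv/repr_pword. Qed.

Lemma pres_mulA : associative pres_mul.
Proof.
move=> g h k; rewrite -(pwordK g) -(pwordK h) -(pwordK k).
by rewrite !pres_mulE catA.
Qed.

Lemma pres_mul1g : left_id pres_one pres_mul.
Proof. by move=> g; rewrite -(pwordK g) pres_mulE. Qed.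

Lemma pres_mulg1 : right_id pres_one pres_mul.
Proof. by move=> g; rewrite -(pwordK g) pres_mulE cats0. Qed.

Lemma pres_mulVg : left_inverse pres_one pres_inv pres_mul.
Proof.
move=> g; rewrite -(pwordK g) pres_invE pres_mulE.
exact/eqP/pwordP/pres_mulVw.
Qed.

Lemma pres_mulgV : right_inverse pres_one pres_inv pres_mul.
Proof.
move=> g; rewrite -(pwordK g) pres_invE pres_mulE.
exact/eqP/pwordP/pres_mulwV.
Qed.

HB.instance Definition _ := isGroup.Build presented
  pres_mulA pres_mul1g pres_mulg1 pres_mulVg pres_mulgV.

End Presentation.

Section GroupRing.
Variable G : groupType.

(* The additive group of finitely supported functions G -> int. The ring
   structure of {malg int[G]} in the library requires a monoid without
   nontrivial units, so the product is defined here. *)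
Definition group_ring := {malg int[G]}.

HB.instance Definition _ := GRing.Zmodule.copy group_ring {malg int[G]}.

Implicit Types (a b : G) (p q : group_ring).

Definition gr (a : G) : group_ring := << 1 *g a >>.

Definition gr_mul p q : group_ring :=
  \sum_(a <- msupp p) \sum_(b <- msupp q) << p@_a * q@_b *g (a * b)%g >>.

Lemma gr_mulw (d1 d2 : {fset G}) p q :
  (msupp p `<=` d1)%fset -> (msupp q `<=` d2)%fset ->
  gr_mul p q = \sum_(a <- d1) \sum_(b <- d2) << p@_a * q@_b *g (a * b)%g >>.
Proof.
move=> le_d1 le_d2; rewrite /gr_mul (big_fset_incl _ le_d1) /=.
  apply/eq_bigr=> k1 _; apply/big_fset_incl => // k _ /mcoeff_outdom ->.
  by rewrite mulr0 monalgU0.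
move=> k _ /mcoeff_outdom g1k.
by rewrite big1 => // k' _; rewrite g1k mul0r monalgU0.
Qed.

Lemma gr_mulUU (c1 c2 : int) a b :
  gr_mul << c1 *g a >> << c2 *g b >> = << c1 * c2 *g (a * b)%g >>.
Proof. by rewrite (gr_mulw msuppU_le msuppU_le) !big_seq_fset1 !mcoeffUU. Qed.

Lemma gr_mul0g : left_zero 0 gr_mul.
Proof. by move=> p; rewrite /gr_mul msupp0 big_seq_fset0. Qed.

Lemma gr_mulg0 : right_zero 0 gr_mul.
Proof. by move=> p; rewrite /gr_mul exchange_big msupp0 big_seq_fset0. Qed.

Lemma gr_mulDl : left_distributive gr_mul +%R.
Proof.
move=> p1 p2 q.
rewrite [in RHS](gr_mulw (fsubsetUl _ (msupp p2)) (fsubset_refl _)).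
rewrite [in RHS](gr_mulw (fsubsetUr (msupp p1) _) (fsubset_refl _)).
rewrite (gr_mulw (msuppD_le _ _) (fsubset_refl _)).
rewrite -big_split /=; apply/eq_bigr=> k1 _.
rewrite -big_split /=; apply/eq_bigr=> k2 _.
by rewrite mcoeffD mulrDl monalgUD.
Qed.

Lemma gr_mulDr : right_distributive gr_mul +%R.
Proof.
move=> p q1 q2.
rewrite [in RHS](gr_mulw (fsubset_refl _) (fsubsetUl _ (msupp q2))).
rewrite [in RHS](gr_mulw (fsubset_refl _) (fsubsetUr (msupp q1) _)).
rewrite (gr_mulw (fsubset_refl _) (msuppD_le _ _)).
rewrite -big_split /=; apply/eq_bigr=> k1 _.
rewrite -big_split /=; apply/eq_bigr=> k2 _.
by rewrite mcoeffD mulrDr monalgUD.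
Qed.

Lemma gr_mulEr p q :
  gr_mul p q = \sum_(a <- msupp p) gr_mul << p@_a *g a >> q.
Proof.
apply/eq_bigr=> a _.
by rewrite (gr_mulw msuppU_le (fsubset_refl _)) big_seq_fset1 mcoeffUU.
Qed.

Lemma gr_mulEl p q :
  gr_mul p q = \sum_(b <- msupp q) gr_mul p << q@_b *g b >>.
Proof.
rewrite /gr_mul exchange_big; apply/eq_bigr=> b _.
by rewrite [RHS](gr_mulw (fsubset_refl _) msuppU_le) exchange_big
  big_seq_fset1 mcoeffUU.
Qed.

Lemma gr_mul1g : left_id (gr 1%g) gr_mul.
Proof.
move=> p; rewrite gr_mulEl [RHS]monalgE; apply/eq_bigr=> b _.
by rewrite gr_mulUU mul1r mul1g.
Qed.

Lemma gr_mulg1 : right_id (gr 1%g) gr_mul.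
Proof.
move=> p; rewrite gr_mulEr [RHS]monalgE; apply/eq_bigr=> b _.
by rewrite gr_mulUU mulr1 mulg1.
Qed.

Lemma gr_mulA : associative gr_mul.
Proof.
move=> p q r.
rewrite [RHS](big_morph (gr_mul^~ _) (fun _ _ => gr_mulDl _ _ _) (gr_mul0g _)).
rewrite gr_mulEr; apply/eq_bigr=> k1 _.
rewrite [LHS](big_morph (gr_mul _) (fun _ _ => gr_mulDr _ _ _) (gr_mulg0 _)).
rewrite [RHS](big_morph (gr_mul^~ _) (fun _ _ => gr_mulDl _ _ _) (gr_mul0g _)).
apply/eq_bigr=> k2 _.
rewrite [LHS](big_morph (gr_mul _) (fun _ _ => gr_mulDr _ _ _) (gr_mulg0 _)).
rewrite gr_mulEl; apply/eq_bigr=> k3 _.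
by rewrite !gr_mulUU mulrA mulgA.
Qed.

Lemma gr_oner_neq0 : gr 1%g != 0.
Proof.
by apply/eqP/malgP=> /(_ 1%g) /eqP; rewrite mcoeffUU mcoeff0 oner_eq0.
Qed.

HB.instance Definition _ := GRing.Zmodule_isNzRing.Build group_ring
  gr_mulA gr_mul1g gr_mulg1 gr_mulDl gr_mulDr gr_oner_neq0.

Definition aug p : int := \sum_(a <- msupp p) p@_a.

Lemma augE p : aug p = mmap idfun (fun=> 1) p.
Proof. by apply/eq_bigr=> a _; rewrite mulr1. Qed.

Lemma aug_is_zmod_morphism : zmod_morphism aug.
Proof. by move=> p q; rewrite !augE raddfB. Qed.

HB.instance Definition _ :=
  GRing.isZmodMorphism.Build group_ring int aug aug_is_zmod_morphism.

Lemma augU (c : int) a : aug << c *g a >> = c.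
Proof. by rewrite augE mmapU mulr1. Qed.

Lemma aug_is_monoid_morphism : monoid_morphism aug.
Proof.
split=> [|p q]; first exact: augU.
rewrite [p * q]/(gr_mul p q) raddf_sum mulr_suml; apply/eq_bigr=> a _.
rewrite raddf_sum mulr_sumr; apply/eq_bigr=> b _; exact: augU.
Qed.

HB.instance Definition _ :=
  GRing.isMonoidMorphism.Build group_ring int aug aug_is_monoid_morphism.

(* int with every a in G acting as the identity. *)
Definition triv_mod := int.

HB.instance Definition _ := GRing.Zmodule.copy triv_mod int.

Definition triv_scale p (n : triv_mod) : triv_mod := aug p * n.

Lemma triv_scaleA p q n : triv_scale p (triv_scale q n) = triv_scale (p * q) n.
Proof. by rewrite /triv_scale rmorphM mulrA. Qed.

Lemma triv_scale1 : left_id 1 triv_scale.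
Proof. by move=> n; rewrite /triv_scale rmorph1 mul1r. Qed.

Lemma triv_scaleDr : right_distributive triv_scale +%R.
Proof. by move=> p m n; apply: mulrDr. Qed.

Lemma triv_scaleDl n : {morph triv_scale^~ n : p q / p + q}.
Proof. by move=> p q; rewrite /triv_scale raddfD; apply: mulrDl. Qed.

HB.instance Definition _ := GRing.Zmodule_isLmodule.Build group_ring triv_mod
  triv_scaleA triv_scale1 triv_scaleDr triv_scaleDl.

Lemma triv_gr_scale a (n : triv_mod) : gr a *: n = n.
Proof. by rewrite [_ *: _]/(triv_scale _ _) /triv_scale augU; apply: mul1r. Qed.

(* The augmentation, on the free module of rank one. *)
Definition aug1 (v : 'rV[group_ring]_1) : triv_mod := aug (v 0 0).

Lemma aug1_is_linear : linear aug1.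
Proof.
move=> p u v; rewrite /aug1 !mxE; apply: etrans (raddfD aug _ _) _.
by congr (_ + _); exact: (rmorphM aug).
Qed.

HB.instance Definition _ := GRing.isLinear.Build group_ring
  'rV[group_ring]_1 triv_mod *:%R aug1 aug1_is_linear.

Definition norm_sum (a : G) (m : nat) : group_ring :=
  \sum_(i < m.+1) gr (a ^+ i)%g.

End GroupRing.

Definition exact_at (U V W : zmodType) (f : U -> V) (g : V -> W) : Prop :=
  forall v, g v = 0 <-> exists u, f u = v.

(* The free modules are the left A-modules 'rV[A]_(r n), and d n is the map
   v |-> v *m d n from degree n.+1 to degree n. *)
Definition free_resolution (A : nzRingType) (M : lmodType A) (r : nat -> nat)
    (d : forall n, 'M[A]_(r n.+1, r n)) (e : {linear 'rV[A]_(r 0%N) -> M}) :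
    Prop :=
  [/\ forall m, exists v, e v = m,
      exact_at (fun v : 'rV[A]_(r 1%N) => v *m d 0%N) e
    & forall n, exact_at (fun v : 'rV[A]_(r n.+2) => v *m d n.+1)
                         (fun v : 'rV[A]_(r n.+1) => v *m d n)].

Definition rows_mx (A : nzRingType) (m n : nat) (s : seq (seq A)) :
    'M[A]_(m, n) :=
  \matrix_(i < m, j < n) nth 0 (nth [::] s i) j.

Section Matrices.
Variables (A : nzRingType) (x y z N : A).

Definition heis_mx1 : 'M[A]_(3, 1) := rows_mx 3 1
  [:: [:: x - 1];
      [:: y - 1];
      [:: z - 1]].

Definition heis_mx2 : 'M[A]_(4, 3) := rows_mx 4 3
  [:: [:: 0;         0;     N    ];
      [:: 1 - z * y; x - z; -1   ];
      [:: 1 - z;     0;     x - 1];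
      [:: 0;         1 - z; y - 1]].

Definition heis_mx3 : 'M[A]_(4, 4) := rows_mx 4 4
  [:: [:: x - 1; 0;     - N;       0    ];
      [:: y - 1; 0;     0;         - N  ];
      [:: z - 1; 0;     0;         0    ];
      [:: 0;     z - 1; 1 - z * y; x - z]].

Definition heis_mx4 : 'M[A]_(4, 4) := rows_mx 4 4
  [:: [:: 0;         0;     N;     0];
      [:: 1 - z * y; x - z; -1;    N];
      [:: 1 - z;     0;     x - 1; 0];
      [:: 0;         1 - z; y - 1; 0]].

End Matrices.

Section Heisenberg.
Variable k : nat.

Definition letter (i : 'I_3) : word 'I_3 := [:: (i, false)].
Definition wx := letter (@Ordinal 3 0 isT).
Definition wy := letter (@Ordinal 3 1 isT).
Definition wz := letter (@Ordinal 3 2 isT).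

Definition heis_rels : seq (word 'I_3 * word 'I_3) :=
  [:: (wcomm wx wy, wz); (wcomm wx wz, [::]); (wcomm wy wz, [::]);
      (flatten (nseq k wz), [::])].

Definition heis : groupType := presented heis_rels.

Definition hx : heis := pword heis_rels wx.
Definition hy : heis := pword heis_rels wy.
Definition hz : heis := pword heis_rels wz.

Local Notation ZH := (group_ring heis).
Local Notation x := (gr hx).
Local Notation y := (gr hy).
Local Notation z := (gr hz).
Local Notation N := (norm_sum hz k.-1).

Definition heis_rank (n : nat) : nat :=
  match n with 0 => 1 | 1 => 3 | _ => 4 end.

(* Indexed by the target degree: heis_d n is the differential from degree n.+1
   to degree n. *)
Definition heis_d (n : nat) : 'M[ZH]_(heis_rank n.+1, heis_rank n) :=
  match n with
  | 0 => heis_mx1 x y z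
  | 1 => heis_mx2 x y z N
  | m.+2 => if odd m then heis_mx4 x y z N else heis_mx3 x y z N
  end.

End Heisenberg.

(* Main.v *)
(* Put t = z - 1, which is central. Row elimination reduces exactness in every
   degree to five facts about the group ring A: p t = 0 iff p is a multiple of
   N; p N = 0 iff p is a multiple of t; x - 1 is a nonzerodivisor modulo t;
   (1 - z y, x - z) generates the syzygies of (x - 1, y - 1) modulo t; and
   x - 1, y - 1, t generate the augmentation ideal. The first four follow from
   identities between Z-linear maps A -> A, which need only be checked on group
   elements: the contracting homotopy of the cyclic group <z>, and division by
   s - 1 along a homomorphism phi : G -> Z with phi s = 1. The coordinates that
   define these maps come from evaluating words in the integral Heisenberg
   group, whose central coordinate is well defined modulo k on H_k. *)
Require Import Defs.
From HB Require Import structures.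
From mathcomp Require Import all_boot all_order all_algebra.
From mathcomp Require Import generic_quotient.
From mathcomp.multinomials Require Import monalg.
From Stdlib Require Ncring_tac.

Set Implicit Arguments.
Unset Strict Implicit.
Unset Printing Implicit Defensive.

Import GRing.Theory.

Local Open Scope ring_scope.

(** * Identities in a non-commutative ring, by reflection *)

#[local] Instance nzRing_ops (A : nzRingType) :
  @Ncring.Ring_ops A 0 1 +%R *%R (fun a b => a - b) -%R eq := {}.

#[local] Instance nzRing_Ring (A : nzRingType) :
  @Ncring.Ring A 0 1 +%R *%R (fun a b => a - b) -%R eq (nzRing_ops A).
Proof.
split=> //; try by [move=> ? ? -> ? ? -> | move=> ? ? -> ].
- exact: RelationClasses.eq_equivalence.
- exact: add0r.
- exact: addrC.
- exact: addrA.
- exact: mul1r.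
- exact: mulr1.
- exact: mulrA.
- exact: mulrDl.
- by move=> a b c; exact: mulrDr.
- exact: subrr.
Qed.

Local Ltac ncring := Ncring_tac.non_commutative_ring.

(** * Row elimination *)

Lemma exact_at_mulmx (A : nzRingType) (m n l : nat)
    (d' : 'M[A]_(m, n)) (d : 'M[A]_(n, l)) : d' *m d = 0 ->
    (forall v : 'rV_n, v *m d = 0 -> exists u : 'rV_m, u *m d' = v) ->
  exact_at (fun u : 'rV_m => u *m d') (fun v : 'rV_n => v *m d).
Proof.
move=> dd ex v; split; first exact: ex.
by move=> [u <-]; rewrite -mulmxA dd mulmx0.
Qed.

Section Exactness.
Variables (A : nzRingType) (x y z N : A).

Local Notation rv n s := (rows_mx 1 n [:: s]).

Lemma rv1P (v : 'rV[A]_1) : v = rv 1 [:: v 0 0].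
Proof. by apply/rowP => j; rewrite !mxE ord1. Qed.

Lemma rv3P (v : 'rV[A]_3) : exists a b c, v = rv 3 [:: a; b; c].
Proof.
exists (v 0 0), (v 0 1), (v 0 (1 + 1)); apply/rowP => -[[|[|[]]] // lt_j];
  by rewrite !mxE /=; congr (v _ _); apply/val_inj.
Qed.

Lemma rv4P (v : 'rV[A]_4) : exists a b c d, v = rv 4 [:: a; b; c; d].
Proof.
exists (v 0 0), (v 0 1), (v 0 (1 + 1)), (v 0 (1 + 1 + 1)).
apply/rowP => -[[|[|[|[]]]] // lt_j];
  by rewrite !mxE /=; congr (v _ _); apply/val_inj.
Qed.

Lemma rv1_eq0 (a : A) : rv 1 [:: a] = 0 -> a = 0.
Proof. by move/rowP => /(_ 0); rewrite !mxE. Qed.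

Lemma rv3_eq0 (a b c : A) : rv 3 [:: a; b; c] = 0 -> [/\ a = 0, b = 0 & c = 0].
Proof.
move=> /rowP v0; split; [have := v0 0 | have := v0 1 | have := v0 (1 + 1)];
by rewrite !mxE.
Qed.

Lemma rv4_eq0 (a b c d : A) :
  rv 4 [:: a; b; c; d] = 0 -> [/\ a = 0, b = 0, c = 0 & d = 0].
Proof.
move=> /rowP v0; split;
  [have := v0 0 | have := v0 1 | have := v0 (1 + 1) | have := v0 (1 + 1 + 1)];
by rewrite !mxE.
Qed.

Lemma mul_heis_mx1 (a b c : A) :
  rv 3 [:: a; b; c] *m heis_mx1 x y z =
  rv 1 [:: a * (x - 1) + b * (y - 1) + c * (z - 1)].
Proof.
apply/rowP => j; rewrite ord1 !mxE !big_ord_recr big_ord0 /= !mxE /=; ncring.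
Qed.

Lemma mul_heis_mx2 (p q r s : A) :
  rv 4 [:: p; q; r; s] *m heis_mx2 x y z N =
  rv 3 [:: q * (1 - z * y) + r * (1 - z); q * (x - z) + s * (1 - z);
           p * N - q + r * (x - 1) + s * (y - 1)].
Proof.
apply/rowP => -[[|[|[]]] // lt_j];
  rewrite !mxE !big_ord_recr big_ord0 /= !mxE /=; ncring.
Qed.

Lemma mul_heis_mx3 (p q r s : A) :
  rv 4 [:: p; q; r; s] *m heis_mx3 x y z N =
  rv 4 [:: p * (x - 1) + q * (y - 1) + r * (z - 1); s * (z - 1);
           s * (1 - z * y) - p * N; s * (x - z) - q * N].
Proof.
apply/rowP => -[[|[|[|[]]]] // lt_j];
  rewrite !mxE !big_ord_recr big_ord0 /= !mxE /=; ncring.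
Qed.

Lemma mul_heis_mx4 (p q r s : A) :
  rv 4 [:: p; q; r; s] *m heis_mx4 x y z N =
  rv 4 [:: q * (1 - z * y) + r * (1 - z); q * (x - z) + s * (1 - z);
           p * N - q + r * (x - 1) + s * (y - 1); q * N].
Proof.
apply/rowP => -[[|[|[|[]]]] // lt_j];
  rewrite !mxE !big_ord_recr big_ord0 /= !mxE /=; ncring.
Qed.

Hypotheses (Exy : x * y - z * y * x = 0) (Exz : x * z - z * x = 0)
  (Eyz : y * z - z * y = 0) (EN : N * (z - 1) = 0) (EN' : (z - 1) * N = 0)
  (ENx : N * x - x * N = 0) (ENy : N * y - y * N = 0).

(** On a generic row, the entry is formally a combination of the left-hand sides of [EN], [Exy],
    [Exz] and [Eyz]; [ncring] checks this, and the hypotheses then kill every term. The next three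
    products follow the same pattern. *)
Lemma heis_mx21 : heis_mx2 x y z N *m heis_mx1 x y z = 0.
Proof.
apply/row_matrixP => i; rewrite row0 rowE mulmxA.
have [p [q [r [s ->]]]] := rv4P (delta_mx 0 i).
rewrite mul_heis_mx2 mul_heis_mx1.
rewrite (_ : _ + _ = p * (N * (z - 1)) + q * (x * y - z * y * x)
  + r * (x * z - z * x) + s * (y * z - z * y)); last by ncring.
by rewrite EN Exy Exz Eyz !mulr0 !addr0; apply/rowP=> j; rewrite !mxE ord1.
Qed.

Lemma heis_mx32 : heis_mx3 x y z N *m heis_mx2 x y z N = 0.
Proof.
apply/row_matrixP => i; rewrite row0 rowE mulmxA.
have [p [q [r [s ->]]]] := rv4P (delta_mx 0 i).
rewrite mul_heis_mx3 mul_heis_mx2; apply/rowP => -[[|[|[]]] // lt_j];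
  rewrite !mxE /=.
- rewrite (_ : _ + _ = p * (N * (z - 1)) + s * z * (y * z - z * y));
    last by ncring.
  by rewrite EN Eyz !mulr0 addr0.
- rewrite (_ : _ + _ = q * (N * (z - 1)) - s * (x * z - z * x)); last by ncring.
  by rewrite EN Exz !mulr0 subr0.
- rewrite (_ : _ + _ = r * ((z - 1) * N) + s * (x * y - z * y * x)
    - p * (N * x - x * N) - q * (N * y - y * N)); last by ncring.
  by rewrite EN' Exy ENx ENy !mulr0 !subr0 addr0.
Qed.

Lemma heis_mx43 : heis_mx4 x y z N *m heis_mx3 x y z N = 0.
Proof.
apply/row_matrixP => i; rewrite row0 rowE mulmxA.
have [p [q [r [s ->]]]] := rv4P (delta_mx 0 i).
rewrite mul_heis_mx4 mul_heis_mx3; apply/rowP => -[[|[|[|[]]]] // lt_j];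
  rewrite !mxE /=.
- rewrite (_ : _ + _ = p * (N * (z - 1)) + q * (x * y - z * y * x)
    + r * (x * z - z * x) + s * (y * z - z * y)); last by ncring.
  by rewrite EN Exy Exz Eyz !mulr0 !addr0.
- by rewrite -mulrA EN mulr0.
- rewrite (_ : _ - _ = r * ((z - 1) * N) - q * z * (N * y - y * N)
    + q * ((z - 1) * N - N * (z - 1)) * y); last by ncring.
  by rewrite EN EN' ENy !subr0 !mulr0 mul0r subr0 addr0.
- rewrite (_ : _ - _ = s * ((z - 1) * N) + q * (N * x - x * N)
    + q * ((z - 1) * N - N * (z - 1))); last by ncring.
  by rewrite EN EN' ENx !subr0 !mulr0 !addr0.
Qed.

Lemma heis_mx34 : heis_mx3 x y z N *m heis_mx4 x y z N = 0.
Proof.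
apply/row_matrixP => i; rewrite row0 rowE mulmxA.
have [p [q [r [s ->]]]] := rv4P (delta_mx 0 i).
rewrite mul_heis_mx3 mul_heis_mx4; apply/rowP => -[[|[|[|[]]]] // lt_j];
  rewrite !mxE /=.
- rewrite (_ : _ + _ = p * (N * (z - 1)) + s * z * (y * z - z * y));
    last by ncring.
  by rewrite EN Eyz !mulr0 addr0.
- rewrite (_ : _ + _ = q * (N * (z - 1)) - s * (x * z - z * x)); last by ncring.
  by rewrite EN Exz !mulr0 subr0.
- rewrite (_ : _ + _ = r * ((z - 1) * N) + s * (x * y - z * y * x)
    - p * (N * x - x * N) - q * (N * y - y * N)); last by ncring.
  by rewrite EN' Exy ENx ENy !mulr0 !subr0 addr0.
- by rewrite -mulrA EN' mulr0.
Qed.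

Hypothesis ann_z1 : forall p, p * (z - 1) = 0 -> exists q, p = q * N.
Hypothesis ann_N : forall p, p * N = 0 -> exists q, p = q * (z - 1).
Hypothesis x_regular : forall p q, p * (x - 1) = q * (z - 1) ->
  exists q', p = q' * (z - 1).
Hypothesis koszul : forall a b d, a * (x - 1) + b * (y - 1) = d * (z - 1) ->
  exists e a' b', a = e * (1 - z * y) + a' * (z - 1) /\
                  b = e * (x - z) + b' * (z - 1).

(** Since [(1 - z * y) * (x - 1) + (x - z) * (y - 1)] reduces to [z - 1], inserting the Koszul form
    of [a] and [b] leaves [c + e + a' * (x - 1) + b' * (y - 1)], annihilated by [z - 1]. It is
    [f * N], and [f] becomes the first coordinate. *)
Lemma heis_exact1 (a b c : A) : a * (x - 1) + b * (y - 1) + c * (z - 1) = 0 ->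
  exists p q r s,
    rv 4 [:: p; q; r; s] *m heis_mx2 x y z N = rv 3 [:: a; b; c].
Proof.
move=> abc; have [|e [a' [b' [aE bE]]]] := koszul (a := a) (b := b) (d := - c).
  by apply/eqP; rewrite mulNr -addr_eq0 abc.
have [|f fE] := ann_z1 (p := c + e + a' * (x - 1) + b' * (y - 1)).
  rewrite (_ : _ * _ = a * (x - 1) + b * (y - 1) + c * (z - 1)
    - e * (x * y - z * y * x) + a' * (x * z - z * x) + b' * (y * z - z * y)).
    by rewrite abc Exy Exz Eyz !mulr0 subr0 !addr0.
  by rewrite aE bE; ncring.
exists f, e, (- a'), (- b'); rewrite mul_heis_mx2 -fE aE bE.
by congr rows_mx; do ![congr (_ :: _)]; ncring.
Qed.

Lemma heis_exact2 (p q r s : A) :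
  rv 4 [:: p; q; r; s] *m heis_mx2 x y z N = 0 ->
  exists u, u *m heis_mx3 x y z N = rv 4 [:: p; q; r; s].
Proof.
rewrite mul_heis_mx2 => /rv3_eq0[E1 E2 E3].
(* [E2] rearranges to [q * (x - 1) = (q + s) * (z - 1)]. *)
have [|q' qE] := x_regular (p := q) (q := q + s).
  apply/eqP; rewrite -subr_eq0 -[X in _ == X]E2; apply/eqP; ncring.
(* With [q = q' * (z - 1)], [E1] and [E2] determine [r] and [s] as [q' * (1 - z * y)] and
   [q' * (x - z)] up to multiples of [N]. *)
have [|r' rE] := ann_z1 (p := r - q' * (1 - z * y)).
  rewrite (_ : _ * _ = - (q * (1 - z * y) + r * (1 - z))
    + q' * z * (y * z - z * y)); last by rewrite qE; ncring.
  by rewrite E1 Eyz oppr0 mulr0 addr0.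
have [|s' sE] := ann_z1 (p := s - q' * (x - z)).
  rewrite (_ : _ * _ = - (q * (x - z) + s * (1 - z)) - q' * (x * z - z * x));
    last by rewrite qE; ncring.
  by rewrite E2 Exz !oppr0 mulr0 subr0.
(* After the same substitutions in [E3] the [q'] terms cancel through [Exy], leaving a factor
   annihilated by [N]. *)
have [|p' pE] := ann_N (p := p + r' * (x - 1) + s' * (y - 1)).
  rewrite (_ : _ * _ = (p * N - q + r * (x - 1) + s * (y - 1))
    - r' * (N * x - x * N) - s' * (N * y - y * N) - q' * (x * y - z * y * x)).
    by rewrite E3 ENx ENy Exy !mulr0 !subr0.
  rewrite -[r](subrK (q' * (1 - z * y))) -[s](subrK (q' * (x - z))).
  by rewrite rE sE qE; ncring.
exists (rv 4 [:: - r'; - s'; p'; q']); rewrite mul_heis_mx3 -pE -qE.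
rewrite [_ * (1 - _) - _](_ : _ = r); last first.
  by rewrite -[RHS](subrK (q' * (1 - z * y))) rE; ncring.
rewrite [_ * (x - z) - _](_ : _ = s); last first.
  by rewrite -[RHS](subrK (q' * (x - z))) sE; ncring.
by congr rows_mx; do ![congr (_ :: _)]; ncring.
Qed.

(** [E1] is the hypothesis of [heis_exact1], which yields a row with the right first three entries.
    The last column of [heis_mx4] contributes only [e * N], so [e * N = s] remains. *)
Lemma heis_exact3 (p q r s : A) :
  rv 4 [:: p; q; r; s] *m heis_mx3 x y z N = 0 ->
  exists u, u *m heis_mx4 x y z N = rv 4 [:: p; q; r; s].
Proof.
rewrite mul_heis_mx3 => /rv4_eq0[E1 E2 E3 E4].
have [f [e [a [b]]]] := heis_exact1 E1; rewrite mul_heis_mx2 => uE.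
have qE : e * (x - z) + b * (1 - z) = q.
  by have /rowP/(_ 1) := uE; rewrite !mxE.
have [s' sE] := ann_z1 E2.
(* With [s = s' * N], [E4] says that [N] kills [(s' - e) * (x - z)]. As [x - z] is [x - 1] modulo
   [z - 1], regularity makes [s' - e] a multiple of [z - 1], whence [s' * N = e * N]. *)
have [|g gE] := ann_N (p := (s' - e) * (x - z)).
  rewrite (_ : _ * _ = (s * (x - z) - q * N) - b * ((z - 1) * N)
     - s' * (N * x - x * N) + s' * ((N * (z - 1)) - (z - 1) * N)).
    by rewrite E4 EN EN' ENx !(subr0, mulr0, addr0).
  by rewrite sE -qE; ncring.
have [|h hE] := x_regular (p := s' - e) (q := g + (s' - e)).
  by rewrite [RHS]mulrDl -gE; ncring.
exists (rv 4 [:: f; e; a; b]); rewrite mul_heis_mx4.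
have -> : e * N = s by rewrite sE -(subrK e s') hE mulrDl -mulrA EN' mulr0 add0r.
apply/rowP => -[[|[|[|[]]]] // lt_j].
- by have /rowP/(_ 0) := uE; rewrite !mxE.
- by have /rowP/(_ 1) := uE; rewrite !mxE.
- by have /rowP/(_ (1 + 1)) := uE; rewrite !mxE.
- by rewrite !mxE.
Qed.

Lemma heis_exact_at21 :
  exact_at (fun v : 'rV_4 => v *m heis_mx2 x y z N)
           (fun v : 'rV_3 => v *m heis_mx1 x y z).
Proof.
apply: (exact_at_mulmx heis_mx21) => v; have [a [b [c ->]]] := rv3P v.
rewrite mul_heis_mx1 => /rv1_eq0/heis_exact1[p [q [r [s E]]]].
by exists (rv 4 [:: p; q; r; s]).
Qed.

Lemma heis_exact_at32 :
  exact_at (fun v : 'rV_4 => v *m heis_mx3 x y z N)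
           (fun v : 'rV_4 => v *m heis_mx2 x y z N).
Proof.
apply: (exact_at_mulmx heis_mx32) => v; have [p [q [r [s ->]]]] := rv4P v.
exact: heis_exact2.
Qed.

Lemma heis_exact_at43 :
  exact_at (fun v : 'rV_4 => v *m heis_mx4 x y z N)
           (fun v : 'rV_4 => v *m heis_mx3 x y z N).
Proof.
apply: (exact_at_mulmx heis_mx43) => v; have [p [q [r [s ->]]]] := rv4P v.
exact: heis_exact3.
Qed.

(** The first three columns of [heis_mx4] form [heis_mx2], so its kernel is already covered by
    [heis_exact2]. *)
Lemma heis_exact_at34 :
  exact_at (fun v : 'rV_4 => v *m heis_mx3 x y z N)
           (fun v : 'rV_4 => v *m heis_mx4 x y z N).
Proof.
apply: (exact_at_mulmx heis_mx34) => v; have [p [q [r [s ->]]]] := rv4P v.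
rewrite mul_heis_mx4 => /rv4_eq0[E1 E2 E3 _]; apply: heis_exact2.
rewrite mul_heis_mx2 E1 E2 E3.
by apply/rowP => -[[|[|[]]] // lt_j]; rewrite !mxE.
Qed.

End Exactness.

(** * Additive maps on group rings *)

HB.lock Definition lin (G : groupType) (f : G -> group_ring G) :
  {additive group_ring G -> group_ring G} := mmap intr f.

Lemma lin_gr (G : groupType) (f : G -> group_ring G) g : lin f (gr g) = f g.
Proof. by rewrite lin.unlock /= mmapU mul1r. Qed.

Section GroupRingMaps.
Variable G : groupType.
Local Notation ZG := (group_ring G).
Implicit Types (g h s : G) (p q : ZG).

Lemma grM g h : gr (g * h)%g = gr g * gr h.
Proof. by apply: esym; apply: etrans (gr_mulUU _ _ _ _) _; rewrite mul1r. Qed.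

Lemma gr1 : gr 1%g = 1 :> ZG.
Proof. by []. Qed.

(** Closure under differences gives zero, sums and integer multiples, so identities between additive
    maps reduce to group elements. *)
Lemma gr_ind (P : ZG -> Prop) : (forall g, P (gr g)) ->
  (forall p q, P p -> P q -> P (p - q)) -> forall p, P p.
Proof.
move=> Pgr PB.
have P0 : P 0 by rewrite -(subrr (gr 1%g)); apply: PB.
have PD p q : P p -> P q -> P (p + q).
  by move=> Pp Pq; rewrite -[q]opprK -[- q]sub0r; apply: (PB _ _ Pp); exact: PB.
have PU g (n : nat) : P << n%:Z *g g >>.
  elim: n => [|n IHn]; first by rewrite monalgU0.
  by rewrite intS monalgUD; apply: PD IHn; exact: Pgr.
move=> p; rewrite [p]monalgE; elim/big_ind: _ => // g _.
case: (mcoeff g p) => n; first exact: PU.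
by rewrite NegzE monalgUN -sub0r; apply: PB P0 _.
Qed.


Lemma gr_central h p : (forall g, h * g = g * h)%g -> gr h * p = p * gr h.
Proof.
move=> hC; elim/gr_ind: p => [g | p q IHp IHq]; first by rewrite -!grM hC.
by rewrite mulrBr mulrBl IHp IHq.
Qed.

(** * Division by s - 1 along a homomorphism to the integers *)

Section Shift.
Variables (phi : G -> int) (s : G).
Hypotheses (phiM : forall g h, phi (g * h)%g = phi g + phi h) (phis : phi s = 1).

(* (1 - s^-n) / (s - 1), for n of either sign. *)
Definition shift_quot (n : int) : ZG :=
  match n with
  | Posz m => \sum_(i < m) gr (s^-1 ^+ i.+1)%g
  | Negz m => - \sum_(i < m.+1) gr (s ^+ i)%g
  end.

(** This recurrence and the value 0 at [n = 0] are all that is used of [shift_quot] afterwards. *)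
Lemma shift_quotS (n : int) : gr s * shift_quot (n + 1) = shift_quot n + 1.
Proof.
case: n => [m | [|m]].
- rewrite addrC -intS [shift_quot _]big_ord_recl mulrDr -grM mulgV addrC gr1.
  congr (_ + _); rewrite mulr_sumr; apply: eq_bigr => i _.
  by rewrite -grM expgS mulgA mulgV mul1g.
- by rewrite [shift_quot _]big_ord0 mulr0 [shift_quot _]/= big_ord1 addNr.
- have -> : Negz m.+1 + 1 = Negz m.
    by rewrite !NegzE intS opprD addrAC addNr add0r.
  rewrite [shift_quot (Negz m.+1)]/=.
  rewrite big_ord_recl opprD addrAC addNr add0r mulrN mulr_sumr.
  by congr (- _); apply: eq_bigr => i _; rewrite -grM -expgS.
Qed.

(** The element is s^-n. Hence [shift_rem] sends a group element to a group element of degree 0. *)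
Lemma shift_quot_gr (n : int) :
  exists2 h, phi h = - n & 1 - shift_quot n * (gr s - 1) = gr h.
Proof.
have phi1 : phi 1%g = 0.
  by apply: (addIr (phi 1%g)); rewrite -phiM mulg1 add0r.
have phiV : phi s^-1%g = -1.
  by apply: (addIr (phi s)); rewrite -phiM mulVg phi1 phis addNr.
have sV : gr s * gr s^-1%g = 1 by rewrite -grM mulgV.
have Vs : gr s^-1%g * gr s = 1 by rewrite -grM mulVg.
have stepE m : gr s * (1 - shift_quot (m + 1) * (gr s - 1))
             = 1 - shift_quot m * (gr s - 1).
  by rewrite mulrBr mulrA shift_quotS; ncring.
elim/int_rect: n => [|n [h hn hE]|n [h hn hE]].
- by exists 1%g; rewrite ?phi1 // [shift_quot _]big_ord0 mul0r subr0.
- exists (s^-1 * h)%g; first by rewrite phiM hn phiV intS opprD.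
  by rewrite grM -hE -(stepE n) mulrA Vs mul1r -addn1 PoszD.
- exists (s * h)%g; first by rewrite phiM hn phis intS; ncring.
  by rewrite grM -hE -(stepE (- n.+1%:Z)) -addn1 PoszD opprD subrK.
Qed.

(* For phi u = 0, this maps u s^n to u (s^n - 1) / (s - 1). *)
Definition shift_div : {additive ZG -> ZG} :=
  lin (fun g => gr g * shift_quot (phi g)).

(** By [shift_quotS], the images of [g * s] and [g] differ by [gr g]. Right multiplication by
    [s - 1] is therefore injective. *)
Lemma shift_divK p : shift_div (p * (gr s - 1)) = p.
Proof.
elim/gr_ind: p => [g | p q IHp IHq]; last by rewrite mulrBl raddfB IHp IHq.
rewrite mulrBr mulr1 -grM raddfB !lin_gr phiM phis grM -mulrA shift_quotS.
by rewrite mulrDr mulr1 addrAC subrr add0r.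
Qed.

Lemma shift_div_mul p h : phi h = 0 -> (forall g, h * g = g * h)%g ->
  shift_div (p * gr h) = shift_div p * gr h.
Proof.
move=> h0 hC; elim/gr_ind: p => [g | p q IHp IHq]; last first.
  by rewrite mulrBl !raddfB IHp IHq -mulrBl.
by rewrite -grM !lin_gr phiM h0 addr0 grM -!mulrA (gr_central _ hC).
Qed.

(* For phi u = 0, this maps u s^n to u. *)
Definition shift_rem p : ZG := p - shift_div p * (gr s - 1).

Lemma shift_remB p q : shift_rem (p - q) = shift_rem p - shift_rem q.
Proof. by rewrite /shift_rem raddfB; ncring. Qed.

Lemma shift_div_rem p h : phi h = 0 -> shift_div (shift_rem p * gr h) = 0.
Proof.
move=> h0; elim/gr_ind: p => [g | p q IHp IHq]; last first.
  by rewrite shift_remB mulrBl raddfB [X in X - _]IHp [X in _ - X]IHq subrr.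
have [h' h'E remE] := shift_quot_gr (phi g).
have -> : shift_rem (gr g) = gr (g * h')%g.
  by rewrite /shift_rem lin_gr grM -remE; ncring.
by rewrite -grM lin_gr !phiM h'E h0 addr0 subrr [shift_quot _]big_ord0 mulr0.
Qed.

End Shift.

(** * Annihilators of z - 1 and of its norm for a central cyclic subgroup *)

Section CentralCyclic.
Variables (z : G) (k : nat) (c : G -> nat).
Hypotheses (zC : (forall g, z * g = g * z)%g) (zk : (z ^+ k.+1 = 1)%g)
  (cS : forall g, c (z * g)%g = ((c g).+1 %% k.+1)%N).

Local Notation N := (norm_sum z k).

Lemma norm_sum_central p : N * p = p * N.
Proof.
rewrite mulr_suml mulr_sumr; apply: eq_bigr => i _; apply: gr_central => g.
elim: (i : nat) => [|n IHn]; first by rewrite mul1g mulg1.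
by rewrite expgS -mulgA IHn mulgA zC mulgA.
Qed.

Lemma mul_norm_sum : N * gr z = N.
Proof.
rewrite mulr_suml [RHS]big_ord_recl big_ord_recr /= addrC; congr (_ + _).
  by rewrite -grM -expgSr zk.
by apply: eq_bigr => i _; rewrite -grM -expgSr.
Qed.

Lemma coord_lt g : (c g < k.+1)%N.
Proof. by rewrite -[g](mulVKg z) cS ltn_mod. Qed.

(** Together with [zk], this forces [z] to have order exactly [k.+1], and each coset of <z> to
    contain one element of coordinate 0. *)
Lemma coordX n g : (c (z ^+ n * g)%g = c g + n %[mod k.+1])%N.
Proof.
elim: n => [|n IHn]; first by rewrite mul1g addn0.
by rewrite expgS -mulgA cS modn_mod -addn1 -modnDml IHn modnDml addn1 addnS.
Qed.

Definition coset_repr g := ((z ^+ c g)^-1 * g)%g.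

Lemma coset_reprK g : (z ^+ c g * coset_repr g)%g = g.
Proof. exact: mulVKg. Qed.

Lemma coord_repr g : c (coset_repr g) = 0%N.
Proof.
have := coordX (c g) (coset_repr g).
rewrite coset_reprK -[X in (X = _ %[mod _])%N]add0n => /eqP.
by rewrite eqn_modDr mod0n modn_small ?coord_lt // => /eqP.
Qed.

Lemma coord_reprX g n : (n < k.+1)%N -> c (z ^+ n * coset_repr g)%g = n.
Proof.
move=> ltnk; have := coordX n (coset_repr g).
by rewrite coord_repr add0n !modn_small ?coord_lt.
Qed.

Lemma coset_reprX g n : (n < k.+1)%N ->
  coset_repr (z ^+ n * coset_repr g)%g = coset_repr g.
Proof. by move=> ltnk; rewrite {1}/coset_repr coord_reprX // mulKg. Qed.

(* A contracting homotopy of the 2-periodic complex of the cyclic group <z>,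
   written z^i g |-> (1 + ... + z^(i-1)) g, and z^i g |-> [i = k] g, for g a
   coset representative. *)
Definition cyc_h0 : {additive ZG -> ZG} :=
  lin (fun g => \sum_(i < c g) gr (z ^+ i * coset_repr g)%g).
Definition cyc_h1 : {additive ZG -> ZG} :=
  lin (fun g => if c g == k then gr (coset_repr g) else 0).

Lemma gr_mulz g : gr g * gr z = gr (z * g)%g.
Proof. by rewrite grM (gr_central _ zC). Qed.

Lemma gr_mul_norm_sum g : gr g * N = \sum_(i < k.+1) gr (z ^+ i * g)%g.
Proof.
by rewrite -norm_sum_central mulr_suml; apply: eq_bigr => i _; rewrite grM.
Qed.

Lemma cyc_h01 p : cyc_h0 (p * (gr z - 1)) + cyc_h1 p * N = p.
Proof.
elim/gr_ind: p => [g | p q IHp IHq]; last first.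
  rewrite mulrBl !raddfB mulrBl addrACA -opprD.
  by rewrite [X in X - _]IHp [X in _ - X]IHq.
rewrite mulrBr mulr1 raddfB gr_mulz -[g]coset_reprK.
move: (coset_repr g) (coord_lt g) (@coord_reprX g) (@coset_reprX g) => u.
move: (c g) => n ltn cE rE; rewrite mulgA -expgS !lin_gr cE // rE //.
(* For [n = k], [z ^+ n.+1] wraps around to 1 and the first [cyc_h0] sum is empty; the term
   [gr u * N] from [cyc_h1] compensates. Otherwise [cyc_h1] vanishes and the two sums telescope. *)
have [->|neq] := eqVneq n k.
  rewrite zk mul1g -[u in c u]mul1g (cE 0%N) // big_ord0 sub0r.
  by rewrite gr_mul_norm_sum big_ord_recr /= addKr.
rewrite mul0r addr0 cE ?rE ?ltnS; last 2 first.
- by rewrite ltn_neqAle neq -ltnS.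
- by rewrite ltn_neqAle neq -ltnS.
by rewrite big_ord_recr /= addrAC subrr add0r.
Qed.

Lemma cyc_h10 p : cyc_h0 p * (gr z - 1) + cyc_h1 (p * N) = p.
Proof.
elim/gr_ind: p => [g | p q IHp IHq]; last first.
  rewrite mulrBl !raddfB mulrBl addrACA -opprD.
  by rewrite [X in X - _]IHp [X in _ - X]IHq.
rewrite -[g]coset_reprK.
move: (coset_repr g) (coord_lt g) (@coord_reprX g) (@coset_reprX g) => u.
move: (c g) => n ltn cE rE; rewrite lin_gr cE // rE //.
(* [N] absorbs powers of [z], and [cyc_h1] sees only the term of coordinate [k] in [gr u * N]. *)
have -> : gr (z ^+ n * u)%g * N = gr u * N.
  elim: n {ltn} => [|n IHn]; first by rewrite mul1g.
  rewrite expgS -mulgA grM -mulrA -norm_sum_central mulrA.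
  by rewrite (gr_central _ zC) mul_norm_sum norm_sum_central.
have -> : cyc_h1 (gr u * N) = gr u.
  rewrite gr_mul_norm_sum raddf_sum big_ord_recr /= big1 => [|i _].
    by rewrite lin_gr cE // rE // eqxx add0r.
  by rewrite lin_gr cE ?(ltn_eqF (ltn_ord i)) // ltnW // ltnS.
elim: n {ltn} => [|n IHn]; first by rewrite big_ord0 mul0r add0r mul1g.
rewrite big_ord_recr mulrDl addrAC IHn /= mulrBr mulr1 gr_mulz mulgA -expgS.
by rewrite addrC subrK.
Qed.

Lemma ann_z1_norm p : p * (gr z - 1) = 0 -> exists q, p = q * N.
Proof.
by move=> pz; exists (cyc_h1 p); rewrite -[LHS]cyc_h01 pz raddf0 add0r.
Qed.

Lemma ann_norm_z1 p : p * N = 0 -> exists q, p = q * (gr z - 1).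
Proof.
by move=> pN; exists (cyc_h0 p); rewrite -[LHS]cyc_h10 pN raddf0 addr0.
Qed.

End CentralCyclic.

(** * Regularity and Koszul syzygies modulo z - 1 *)

Section Koszul.
Variables (x y z : G) (phi psi : G -> int).
Hypotheses (phiM : forall g h, phi (g * h)%g = phi g + phi h)
  (psiM : forall g h, psi (g * h)%g = psi g + psi h)
  (phix : phi x = 1) (phiy : phi y = 0) (phiz : phi z = 0)
  (psiy : psi y = 1) (psiz : psi z = 0)
  (zC : (forall g, z * g = g * z)%g) (xyE : (x * y = z * y * x)%g).

Local Notation X := (gr x).
Local Notation Y := (gr y).
Local Notation Z := (gr z).

Lemma shift_div_mulz1 (chi : G -> int) s p :
  (forall g h, chi (g * h)%g = chi g + chi h) -> chi z = 0 ->
  shift_div chi s (p * (Z - 1)) = shift_div chi s p * (Z - 1).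
Proof. by move=> chiM chiz; rewrite !mulrBr !mulr1 raddfB shift_div_mul. Qed.

(** Division by [s - 1] commutes with multiplication by [Z - 1], because [z] is central of degree 0;
    it is applied to both sides. *)
Lemma shift_regular (chi : G -> int) s p q :
  (forall g h, chi (g * h)%g = chi g + chi h) -> chi s = 1 -> chi z = 0 ->
  p * (gr s - 1) = q * (Z - 1) -> exists q', p = q' * (Z - 1).
Proof.
move=> chiM chis chiz /(congr1 (shift_div chi s)); rewrite shift_divK // => ->.
by rewrite shift_div_mulz1 //; exists (shift_div chi s q).
Qed.

(* Modulo z - 1 the group ring is commutative on x and y, and (1 - z y, x - z)
   becomes the Koszul syzygy (1 - y, x - 1) of (x - 1, y - 1). *)
Lemma koszul_exact (a b d : ZG) :
  a * (X - 1) + b * (Y - 1) = d * (Z - 1) ->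
  exists e a' b', a = e * (1 - Z * Y) + a' * (Z - 1) /\
                  b = e * (X - Z) + b' * (Z - 1).
Proof.
move=> abd; pose D : ZG -> ZG := shift_div phi x.
have DB u v : D (u - v) = D u - D v by exact: raddfB.
have DK u : D (u * (X - 1)) = u by exact: shift_divK.
have DZ u : D (u * (Z - 1)) = D u * (Z - 1) by exact: shift_div_mulz1.
have phi1 : phi 1%g = 0.
  by apply: (addIr (phi 1%g)); rewrite -phiM mulg1 add0r.
(* Divide [b] by [X - 1]. The remainder [b0] lives in degree 0 for [phi], as does [b0 * (Y - 1)], so
   [D] kills the latter. *)
pose e := D b; pose b0 := shift_rem phi x b.
have b0E : b0 = b - e * (X - 1) by [].
have D0 : D (b0 * (Y - 1)) = 0.
  have Dgr h : phi h = 0 -> D (b0 * gr h) = 0 by exact: shift_div_rem.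
  by rewrite mulrBr -gr1 DB !Dgr // subrr.
clearbody b0 e D.
have XY : X * Y - Z * Y * X = 0 by rewrite -!grM xyE subrr.
have ZY : Z * Y - Y * Z = 0 by rewrite -!grM zC subrr.
have ZX : X * Z - Z * X = 0 by rewrite -!grM zC subrr.
have b0y : b0 * (Y - 1) =
    (d - e * Y) * (Z - 1) - (a - e * (1 - Z * Y)) * (X - 1).
  apply/eqP; rewrite b0E -subr_eq0; apply/eqP.
  rewrite (_ : _ - _ = (a * (X - 1) + b * (Y - 1) - d * (Z - 1))
    - e * (X * Y - Z * Y * X) - e * (Z * Y - Y * Z)); last by ncring.
  by rewrite abd subrr XY ZY !mulr0 !subr0.
have aE : a - e * (1 - Z * Y) = D (d - e * Y) * (Z - 1).
  by move: D0; rewrite b0y DB DZ DK => /subr0_eq.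
move: (D _) aE => w aE.
(* Once [a] is replaced through [aE], [b0 * (Y - 1)] is a multiple of [Z - 1]; dividing along [psi]
   shows the same for [b0]. *)
have [|f fE] := shift_regular (chi := psi) (s := y) (p := b0)
    (q := d - e * Y - w * (X - 1)) psiM psiy psiz.
  rewrite b0y aE -[LHS]subr0 -[X in _ - X](mulr0 w) -ZX; ncring.
(* The summand [e] in [e + f] pays for replacing [X - 1] by [X - Z]. *)
exists e, w, (e + f); split; first by rewrite -aE addrC subrK.
rewrite -[b](subrK (e * (X - 1))) -b0E fE; ncring.
Qed.

End Koszul.

End GroupRingMaps.

(** * The group H_k *)

Section LeftSpan.
Variables (A : nzRingType) (x y z : A).

Definition left_span (p : A) : Prop :=
  exists a b c, p = a * (x - 1) + b * (y - 1) + c * (z - 1).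

Lemma left_spanB p q : left_span p -> left_span q -> left_span (p - q).
Proof.
move=> [a [b [c ->]]] [a' [b' [c' ->]]].
by exists (a - a'), (b - b'), (c - c'); ncring.
Qed.

Lemma left_spanD p q : left_span p -> left_span q -> left_span (p + q).
Proof.
move=> [a [b [c ->]]] [a' [b' [c' ->]]].
by exists (a + a'), (b + b'), (c + c'); ncring.
Qed.

Lemma left_spanM p q : left_span q -> left_span (p * q).
Proof. by move=> [a [b [c ->]]]; exists (p * a), (p * b), (p * c); ncring. Qed.

Lemma left_span1 : left_span (x - 1).
Proof. by exists 1, 0, 0; ncring. Qed.

Lemma left_span2 : left_span (y - 1).
Proof. by exists 0, 1, 0; ncring. Qed.

Lemma left_span3 : left_span (z - 1).
Proof. by exists 0, 0, 1; ncring. Qed.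

Lemma left_span_subrr : left_span (1 - 1).
Proof. by exists 0, 0, 0; ncring. Qed.

End LeftSpan.

Lemma mulr_sub1 (A : nzRingType) (a b : A) : a * b - 1 = a * (b - 1) + (a - 1).
Proof. ncring. Qed.

Lemma mulr_inv_sub1 (A : nzRingType) (a b c : A) : a * b = 1 ->
  a * c - 1 = a * (c - 1) - a * (b - 1).
Proof. by move=> ab; rewrite -[1 in LHS]ab; ncring. Qed.

(** * Heisenberg coordinates of words *)

Definition letter_sign (a : 'I_3 * bool) : int := (-1) ^+ a.2.

Definition wdeg (i : nat) (w : word 'I_3) : int :=
  \sum_(a <- w | a.1 == i :> nat) letter_sign a.

Lemma wdeg_cat i u v : wdeg i (u ++ v) = wdeg i u + wdeg i v.
Proof. exact: big_cat. Qed.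

(* The exponent c in the normal form z^c y^b x^a of a word in the integral
   Heisenberg group, where x^a y^b = z^(a b) y^b x^a. *)
Fixpoint wcentral (w : word 'I_3) : int :=
  if w is a :: w' then
    (if a.1 == 2%N :> nat then letter_sign a else 0)
    + (if a.1 == 0%N :> nat then letter_sign a else 0) * wdeg 1 w' + wcentral w'
  else 0.

(** The cross term counts the moves of the [x] letters of [u] past the [y] letters of [v]. *)
Lemma wcentral_cat u v :
  wcentral (u ++ v) = wcentral u + wcentral v + wdeg 0 u * wdeg 1 v.
Proof.
elim: u => [|a u IHu] /=; first by rewrite /wdeg big_nil mul0r addr0 add0r.
rewrite IHu wdeg_cat [wdeg 0 (a :: u)]/wdeg big_cons -/(wdeg 0 u).
by case: (a.1 == 0%N :> nat); ncring.
Qed.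

Lemma wcentral_nseq k : wcentral (flatten (nseq k wz)) = k%:Z.
Proof. by elim: k => //= n ->; rewrite !mul0r addr0 intS. Qed.

Lemma wdeg_nseq k i : (i < 2)%N -> wdeg i (flatten (nseq k wz)) = 0.
Proof.
move=> lti; elim: k => [|n IHn] /=; first exact: big_nil.
by rewrite /wdeg big_cons -/(wdeg _ _) IHn; case: i lti {IHn} => [|[]].
Qed.

(** Induction on the congruence: the cross term in a concatenation depends only on degrees, and
    among the relations only [z^k = 1] changes the central coordinate, by [k]. *)
Lemma pres_eq_coord k u v : pres_eq (heis_rels k) u v ->
  [/\ wdeg 0 u = wdeg 0 v, wdeg 1 u = wdeg 1 v &
      exists m : int, wcentral u = wcentral v + m * k%:Z].
Proof.
elim=> {u v} [u|u v _ [-> -> [m ->]]|u v w _ [-> -> [m ->]] _ [-> -> [n ->]]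
    |u u' v v' _ [u0 u1 [m um]] _ [v0 v1 [n vn]]|a b|u v].
- by split=> //; exists 0; rewrite mul0r addr0.
- by split=> //; exists (- m); ncring.
- by split=> //; exists (n + m); ncring.
- rewrite !wdeg_cat !wcentral_cat u0 u1 v0 v1 um vn; split=> //.
  by exists (m + n); ncring.
- rewrite /wdeg !(big_cons, big_nil) /= /wdeg !(big_cons, big_nil) /=.
  rewrite /letter_sign /=.
  case: a => -[|[|[|]]] //= lta; case: b => /=; split => //; by exists 0.
- rewrite /heis_rels !inE => /or4P[] /eqP[-> ->].
  1-3: by rewrite /wdeg !(big_cons, big_nil) /= /wdeg !(big_cons, big_nil) /=;
    split=> //; exists 0.
  rewrite !wdeg_nseq // wcentral_nseq /wdeg !big_nil; split=> //.
  by exists 1; rewrite mul1r add0r.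
Qed.

(** * Coordinates, relations and augmentation ideal of the group *)

Section Heisenberg.
Variable k : nat.
Local Notation H := (heis k).
Implicit Types g h : H.

Lemma pwordM u v :
  pword (heis_rels k) (u ++ v) = (pword _ u * pword _ v)%g :> H.
Proof. by rewrite -pres_mulE. Qed.

Lemma heis_eq u v : pres_eq (heis_rels k) u v -> pword _ u = pword _ v :> H.
Proof. by move=> uv; apply/eqP/pwordP. Qed.

Definition hdeg (i : nat) g : int := wdeg i (repr g).

Lemma repr_mul g h : pres_eq (heis_rels k) (repr (g * h)%g) (repr g ++ repr h).
Proof. exact: repr_pword. Qed.

Lemma hdegM0 g h : hdeg 0 (g * h)%g = hdeg 0 g + hdeg 0 h.
Proof. by have [E _ _] := pres_eq_coord (repr_mul g h); rewrite -wdeg_cat. Qed.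

Lemma hdegM1 g h : hdeg 1 (g * h)%g = hdeg 1 g + hdeg 1 h.
Proof. by have [_ E _] := pres_eq_coord (repr_mul g h); rewrite -wdeg_cat. Qed.

Lemma hdeg_pword w :
  hdeg 0 (pword _ w) = wdeg 0 w /\ hdeg 1 (pword _ w) = wdeg 1 w.
Proof. by have [E F _] := pres_eq_coord (repr_pword (heis_rels k) w). Qed.

Lemma hdeg_x : hdeg 0 (hx k) = 1.
Proof. by have [-> _] := hdeg_pword wx; rewrite /wdeg big_cons big_nil. Qed.

Lemma hdeg_y : hdeg 0 (hy k) = 0 /\ hdeg 1 (hy k) = 1.
Proof. by have [-> ->] := hdeg_pword wy; rewrite /wdeg !(big_cons, big_nil). Qed.

Lemma hdeg_z : hdeg 0 (hz k) = 0 /\ hdeg 1 (hz k) = 0.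
Proof. by have [-> ->] := hdeg_pword wz; rewrite /wdeg !(big_cons, big_nil). Qed.

Definition hcoord g : nat := `|(wcentral (repr g) %% k)%Z|%N.

Lemma hcoordS g : (0 < k)%N ->
  hcoord (hz k * g)%g = ((hcoord g).+1 %% k)%N.
Proof.
move=> k0.
have zg : pres_eq (heis_rels k) (repr (hz k * g)%g) (wz ++ repr g).
  apply: pres_trans (repr_mul _ _) _; apply: pres_cat (pres_refl _ _).
  exact: repr_pword.
have [_ _ [m mE]] := pres_eq_coord zg.
rewrite /hcoord mE /= !mul0r !addr0 addrC modzMDl -modzDmr.
have: (wcentral (repr g) %% k)%Z >= 0 by apply: modz_ge0; rewrite -lt0n.
by case: (_ %% _)%Z => // n _; rewrite -intS modz_nat.
Qed.

Lemma hgen_ind (P : H -> Prop) : P 1%g ->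
  (forall i g, P g -> P (pword _ (letter i) * g)%g) ->
  (forall i g, P g -> P ((pword _ (letter i))^-1 * g)%g) -> forall g, P g.
Proof.
move=> P1 PM PV g; rewrite -[g]pwordK; elim: (repr g) => [|[i b] w IHw] //.
rewrite -cat1s pwordM; case: b; last exact: PM.
suff -> : pword _ [:: (i, true)] = (pword _ (letter i))^-1%g :> H by exact: PV.
by apply: esym; apply: pres_invE.
Qed.

Lemma hletter (P : H -> Prop) : P (hx k) -> P (hy k) -> P (hz k) ->
  forall i, P (pword _ (letter i)).
Proof.
move=> Px Py Pz [[|[|[|]]] // lti];
[move: Px | move: Py | move: Pz]; congr (P (pword _ (letter _))); exact: val_inj.
Qed.

Lemma hcomm g h u v : g = pword _ u -> h = pword _ v ->
  pword _ (wcomm u v) = (g * h * g^-1 * h^-1)%g :> H.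
Proof. by move=> -> ->; rewrite !pwordM !mulgA -!pres_invE. Qed.

Lemma hxyE : (hx k * hy k = hz k * hy k * hx k)%g.
Proof.
have <- : (hx k * hy k * (hx k)^-1 * (hy k)^-1 = hz k)%g.
  rewrite -(hcomm (u := wx) (v := wy)) //; apply: heis_eq; apply: pres_rel.
  by rewrite !inE eqxx.
by rewrite !mulgVK.
Qed.

Lemma hcomm1 g h : (g * h * g^-1 * h^-1 = 1 -> g * h = h * g)%g.
Proof. by move=> E; rewrite -[RHS]mul1g -E mulgA !mulgVK. Qed.

Lemma hxzE : (hx k * hz k = hz k * hx k)%g.
Proof.
apply: hcomm1; rewrite -(hcomm (u := wx) (v := wz)) //; apply: heis_eq.
by apply: pres_rel; rewrite !inE eqxx orbT.
Qed.

Lemma hyzE : (hy k * hz k = hz k * hy k)%g.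
Proof.
apply: hcomm1; rewrite -(hcomm (u := wy) (v := wz)) //; apply: heis_eq.
by apply: pres_rel; rewrite !inE eqxx !orbT.
Qed.

Lemma hz_central g : (hz k * g = g * hz k)%g.
Proof.
have zl i : (hz k * pword _ (letter i) = pword _ (letter i) * hz k)%g.
  apply: (hletter (P := fun l => hz k * l = l * hz k)%g) => //;
  by rewrite ?hxzE ?hyzE.
elim/hgen_ind: g => [|i g IHg|i g IHg]; first by rewrite mul1g mulg1.
  by rewrite mulgA zl -!mulgA IHg.
apply: (mulgI (pword _ (letter i))).
by rewrite mulgA -zl -mulgA mulVKg IHg -[in RHS]mulgA mulVKg.
Qed.

Lemma hz_exp : (hz k ^+ k = 1)%g.
Proof.
have powE n : (hz k ^+ n = pword _ (flatten (nseq n wz)))%g.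
  by elim: n => //= n IHn; rewrite expgS IHn -cat1s pwordM.
rewrite powE; apply: heis_eq; apply: pres_rel.
by rewrite !inE eqxx !orbT.
Qed.

Local Notation ZH := (group_ring H).
Local Notation x := (gr (hx k)).
Local Notation y := (gr (hy k)).
Local Notation z := (gr (hz k)).

Lemma aug_gr g : aug (gr g) = 1.
Proof. exact: augU. Qed.

Lemma aug_grB1 g : aug (gr g - 1) = 0.
Proof. by rewrite raddfB /= -gr1 !aug_gr subrr. Qed.

Lemma aug_mulB1 (p : ZH) g : aug (p * (gr g - 1)) = 0.
Proof.
by apply: etrans ((aug_is_monoid_morphism H).2 _ _) _; rewrite aug_grB1 mulr0.
Qed.

Lemma aug_left_span (p : ZH) : left_span x y z p -> aug p = 0.
Proof.
move=> [a [b [c ->]]]; have augD : {morph @aug H : u v / u + v} by apply: raddfD.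
by rewrite !augD [X in X + _ + _]aug_mulB1 [X in _ + X + _]aug_mulB1
  [X in _ + X]aug_mulB1.
Qed.

(** For a group element, induct along a word: [mulr_sub1] adds a generator and [mulr_inv_sub1] an
    inverse generator. *)
Lemma aug_ideal (p : ZH) : left_span x y z (p - (aug p)%:~R).
Proof.
have l_span i : left_span x y z (gr (pword _ (letter i)) - 1).
  apply: (hletter (P := fun l => left_span x y z (gr l - 1))) i.
  - exact: left_span1.
  - exact: left_span2.
  - exact: left_span3.
elim/gr_ind: p => [g | p q IHp IHq]; last first.
  by rewrite raddfB intrB opprD addrACA -opprD; apply: left_spanB.
rewrite aug_gr; elim/hgen_ind: g => [|i g IHg|i g IHg].
- exact: left_span_subrr.
- rewrite grM mulr_sub1; apply: left_spanD; last exact: l_span.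
  exact: left_spanM.
- rewrite grM (mulr_inv_sub1 _ (b := gr (pword _ (letter i)))) -?grM ?mulVg //.
  by apply: left_spanB; apply: left_spanM; last exact: l_span.
Qed.

End Heisenberg.

Theorem theorem8p9 (k : nat) (hk : (1 <= k)%N) :
  free_resolution (heis_d k) (aug1 (G := heis k)).
Proof.
case: k hk => // k _.
set x := gr (hx k.+1); set y := gr (hy k.+1); set z := gr (hz k.+1).
pose N := norm_sum (hz k.+1) k.
have zC := @hz_central k.+1.
have NC p : N * p = p * N by exact: norm_sum_central.
have x0 := hdeg_x k.+1.
have [y0 y1] := hdeg_y k.+1; have [z0 z1] := hdeg_z k.+1.
have Exy : x * y - z * y * x = 0 by rewrite -!grM hxyE subrr.
have Exz : x * z - z * x = 0 by rewrite -!grM hxzE subrr.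
have Eyz : y * z - z * y = 0 by rewrite -!grM hyzE subrr.
have EN : N * (z - 1) = 0.
  by rewrite mulrBr mulr1 mul_norm_sum ?subrr // hz_exp.
have EN' : (z - 1) * N = 0 by rewrite -NC.
have ENx : N * x - x * N = 0 by rewrite NC subrr.
have ENy : N * y - y * N = 0 by rewrite NC subrr.
have annz := ann_z1_norm zC (hz_exp _) (fun g => hcoordS g isT).
have annN := ann_norm_z1 zC (hz_exp _) (fun g => hcoordS g isT).
have xreg p q := shift_regular (p := p) (q := q) zC (@hdegM0 k.+1) x0 z0.
have kosz := koszul_exact (@hdegM0 k.+1) (@hdegM1 k.+1)
  x0 y0 z0 y1 z1 zC (hxyE _).
split.
- move=> m; exists (const_mx (m : int)%:~R).
  by rewrite -[LHS]/(aug (const_mx (m : int)%:~R 0 0)) mxE rmorph_int intz.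
- move=> v; rewrite -[X in X = 0 <-> _]/(aug (v 0 0)); split=> [v0 | [u <-]].
    have [a [b [c]]] := aug_ideal (v 0 0); rewrite v0 subr0 => vE.
    exists (rows_mx 1 3 [:: [:: a; b; c]]).
    by rewrite [LHS]mul_heis_mx1 -vE -rv1P.
  have [a [b [c ->]]] := rv3P u; rewrite [_ *m _]mul_heis_mx1 mxE /=.
  by apply: aug_left_span; exists a, b, c.
- case=> [|n]; last case: n => [|n].
  + exact (heis_exact_at21 Exy Exz Eyz EN annz kosz).
  + exact (heis_exact_at32 Exy Exz Eyz EN EN' ENx ENy annz annN xreg).
  (* The differentials are indexed by target degree: for odd [n] the incoming one is [heis_mx3] and
     the outgoing one [heis_mx4], for even [n] the reverse. *)
  + rewrite [heis_d _ n.+3]/= [heis_d _ n.+2]/=; case: (odd n).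
      exact (heis_exact_at34 Exy Exz Eyz EN EN' ENx ENy annz annN xreg).
    exact (heis_exact_at43 Exy Exz Eyz EN EN' ENx ENy annz annN xreg kosz).
Qed.
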